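(* Suppose $d=2$ and assume that $\mathbb{P}$ is admissible. Then there is a norm $\rho$ on $\mathbb{R}^2$ such that for $\mathbb{P}$-almost every realization of the weights, $$\lim_{n\to\infty}\ \max_{\substack{x,y\in\mathbb{Z}^2\\ |x|,|y|\le n}}\ \frac{|D(x,y)-\rho(x-y)|}{n}=0.$$
   Context: $\mathbb{B}(\mathbb{Z}^2)$ is the set of nearest-neighbor edges of $\mathbb{Z}^2$. A probability law $\mathbb{P}$ on $(0,\infty)^{\mathbb{B}(\mathbb{Z}^2)}$ (the law of the edge weights $w$) is admissible if it is stationary and ergodic with respect to translates of $\mathbb{Z}^2$ and the marginal law of $w(e)$ is compactly supported in $(0,\infty)$ for each edge $e$. $\mathbb{Z}^{2\star}=\mathbb{Z}^2+(\tfrac12,\tfrac12)$ is the dual graph. A dual path is a finite sequence $x_0^\star,\dots,x_n^\star$ ($n\ge0$) of vertices of $\mathbb{Z}^{2\star}$ with consecutive ones nearest neighbors; it is self-avoiding if no vertex appears more than once. For $x,y\in\mathbb{Z}^2$, $\Gamma(x,y)$ is the set of all self-avoiding dual paths with $x_0^\star=x+(\frac12,\frac12)$ and $x_n^\star=y+(\frac12,\frac12)$. For $\gamma=(x_0^\star,\dots,x_n^\star)$ let $e_i$ be the edge of $\mathbb{Z}^2$ dual to $(x_{i-1}^\star,x_i^\star)$, and set $\mathfrak{d}(\gamma):=\sum_{i=1}^n w(e_i)$ and $D(x,y):=\inf_{\gamma\in\Gamma(x,y)}\mathfrak{d}(\gamma)$. Here $|\cdot|$ denotes the Euclidean norm.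 *)

(* Defs.v *)
From HB Require Import structures.
From mathcomp Require Import all_boot all_order all_algebra.
From mathcomp Require Import all_classical all_reals all_analysis.
From mathcomp Require Import finmap zify.

Set Implicit Arguments.
Unset Strict Implicit.
Unset Printing Implicit Defensive.

Import Order.TTheory GRing.Theory Num.Theory.
Import numFieldNormedType.Exports.

Local Open Scope classical_set_scope.
Local Open Scope ring_scope.

Notation Z2 := 'rV[int]_2.

Definition adjacent : rel Z2 := fun x y => \sum_(k < 2) `|x 0 k - y 0 k| == 1.

(** [(x, i)] encodes the unoriented edge with endpoints [x] and
    [x + delta_mx 0 i]; each nearest-neighbour edge has exactly one code. *)
Definition edge : Type := (Z2 * 'I_2)%type.

Definition endpoints (e : edge) : Z2 * Z2 := (e.1, e.1 + delta_mx 0 e.2).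

(** A vertex [a + (1/2, 1/2)] of the dual lattice is encoded by [a : Z2].
    [dual_edge a b] is the primal edge crossed by the dual edge between the
    neighbours [a + (1/2, 1/2)] and [b + (1/2, 1/2)]; it runs in the direction
    in which [a] and [b] agree.  Its value on non-neighbours is irrelevant. *)
Definition dual_edge (a b : Z2) : edge :=
  (\row_k Num.max (a 0 k) (b 0 k), if a 0 0 == b 0 0 then 0 else 1).

Lemma dual_edgeC a b : dual_edge a b = dual_edge b a.
Proof.
rewrite /dual_edge eq_sym; congr (_, _).
by apply/rowP => k; rewrite !mxE maxC.
Qed.

Lemma adjacentE (a b : Z2) :
  adjacent a b = (`|a 0 0 - b 0 0| + `|a 0 1 - b 0 1| == 1).
Proof.
rewrite /adjacent big_ord_recl big_ord1 (_ : lift ord0 ord0 = 1)//.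
exact/val_inj.
Qed.

Lemma ord2P (k : 'I_2) : k = 0 \/ k = 1.
Proof. by case: k => -[|[|//]] i; [left|right]; apply/val_inj. Qed.

(** An edge and its dual have the same midpoint and are perpendicular. *)
Lemma dual_edge_midpoint (a b : Z2) : adjacent a b ->
  (endpoints (dual_edge a b)).1 + (endpoints (dual_edge a b)).2 =
  a + b + const_mx 1.
Proof.
rewrite adjacentE /dual_edge => /eqP h; apply/rowP => k; rewrite !mxE eqxx /=.
by have [-> | ->] := ord2P k; case: (a 0 0 =P b 0 0) h => /= e h; lia.
Qed.

Lemma dual_edge_perp (a b : Z2) : adjacent a b ->
  a 0 (dual_edge a b).2 = b 0 (dual_edge a b).2.
Proof.
by rewrite adjacentE /= => /eqP; case: (a 0 0 =P b 0 0) => //= ? ?; lia.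
Qed.

Definition config (R : realType) : Type := edge -> {posnum R}.

HB.instance Definition _ (R : realType) := gen_eqMixin (config R).
HB.instance Definition _ (R : realType) := gen_choiceMixin (config R).
HB.instance Definition _ (R : realType) :=
  isPointed.Build (config R) (fun=> 1%:pos).

Definition cylinders (R : realType) : set (set (config R)) :=
  [set A | exists e (B : set R),
     measurable B /\ A = [set w | B (w e)%:num]].

Arguments cylinders R : clear implicits.

(** The space (0, +oo)^edge with its product sigma-algebra. *)
Notation weights R := (g_sigma_algebraType (cylinders R)).

Definition weight (R : realType) (e : edge) (w : weights R) : R := (w e)%:num.

Lemma measurable_weight (R : realType) (e : edge) :
  measurable_fun setT (@weight R e).
Proof.
by move=> _ B mB; rewrite setTI; apply: sub_sigma_algebra; exists e, B.
Qed.

HB.instance Definition _ (R : realType) (e : edge) :=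
  isMeasurableFun.Build _ _ _ _ (@weight R e) (measurable_weight e).

Definition translate (R : realType) (z : Z2) (w : weights R) : weights R :=
  fun e => w (e.1 + z, e.2).

Section Admissible.
Variables (R : realType) (P : probability (weights R) R).
Local Open Scope ereal_scope.

Definition stationary := forall (z : Z2) (A : set (weights R)),
  measurable A -> P (translate z @^-1` A) = P A.

Definition ergodic := forall A : set (weights R), measurable A ->
  (forall z : Z2, translate z @^-1` A = A) -> P A = 0 \/ P A = 1.

Definition compact_marginals := forall e : edge,
  exists K : set R, [/\ compact K, K `<=` [set t | (0 < t)%R] &
    distribution P (@weight R e : {mfun weights R >-> R}) K = 1].

Definition admissible := [/\ stationary, ergodic & compact_marginals].

End Admissible.

(** [p] stands for the dual path [x :: p], encoded as in [dual_edge]. *)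
Definition Gamma (x y : Z2) : set (seq Z2) :=
  [set p | [/\ path adjacent x p, uniq (x :: p) & last x p = y]].

Definition path_length (R : realType) (w : weights R) (x : Z2) (p : seq Z2)
    : R :=
  \sum_(e <- pairmap dual_edge x p) weight e w.

Definition D (R : realType) (w : weights R) (x y : Z2) : R :=
  inf [set path_length w x p | p in Gamma x y].

(** The norm [`|_|] provided by the library on matrices is the sup norm. *)
Definition enorm (R : realType) (u : 'rV[R]_2) : R :=
  Num.sqrt (\sum_k u 0 k ^+ 2).

Definition toR2 (R : realType) (z : Z2) : 'rV[R]_2 := map_mx intr z.

Definition is_norm (R : realType) (rho : 'rV[R]_2 -> R) :=
  [/\ forall u, 0 <= rho u,
      forall u, rho u = 0 -> u = 0,
      forall (c : R) u, rho (c *: u) = `|c| * rho u &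
      forall u v, rho (u + v) <= rho u + rho v].

Definition ball_pairs (R : realType) (n : nat) : set (Z2 * Z2) :=
  [set xy | enorm (toR2 R xy.1) <= n%:R /\ enorm (toR2 R xy.2) <= n%:R].

Definition deviation (R : realType) (rho : 'rV[R]_2 -> R) (w : weights R)
    (xy : Z2 * Z2) : R :=
  `|D w xy.1 xy.2 - rho (toR2 R (xy.1 - xy.2))|.

(** A maximum, since it ranges over a finite nonempty set: see
    [max_deviation_attained]. *)
Definition max_deviation (R : realType) (rho : 'rV[R]_2 -> R) (w : weights R)
    (n : nat) : R :=
  sup [set deviation rho w xy / n%:R | xy in ball_pairs R n].

Lemma finite_ball (R : realType) n :
  finite_set [set x : Z2 | enorm (toR2 R x) <= n%:R].
Proof.
pose f (x : 'I_(n.*2.+1) * 'I_(n.*2.+1)) : Z2 :=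
  \row_k (if k == 0 then (x.1 : nat)%:Z - n%:Z else (x.2 : nat)%:Z - n%:Z).
apply: (@sub_finite_set _ _ (range f)); last exact: finite_image.
move=> x /= hx.
have bd (k : 'I_2) : `|x 0 k| <= n%:Z.
  have : `|toR2 R x 0 k| <= n%:R.
    apply: le_trans hx; rewrite -sqrtr_sqr /enorm.
    rewrite ler_wsqrtr// (bigD1 k)//= lerDl.
    by apply: sumr_ge0 => i _; exact: sqr_ge0.
  by rewrite mxE -intr_norm -[n%:R]/(n%:Z%:~R) ler_int.
have lt0 (k : 'I_2) : (`|(x 0 k + n%:Z)%R|%N < n.*2.+1)%N.
  by have := bd k; lia.
exists (Ordinal (lt0 0), Ordinal (lt0 1)) => //.
apply/rowP => k; rewrite mxE /=.
have [-> | ->] := ord2P k.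
- by rewrite eqxx; have := bd 0; lia.
- by rewrite /=; have := bd 1; lia.
Qed.

Lemma finite_ball_pairs (R : realType) n : finite_set (ball_pairs R n).
Proof.
have := finite_setX (finite_ball R n) (finite_ball R n).
exact: sub_finite_set.
Qed.

Lemma max_deviation_attained (R : realType) (rho : 'rV[R]_2 -> R)
    (w : weights R) n :
  exists2 xy, ball_pairs R n xy &
    max_deviation rho w n = deviation rho w xy / n%:R /\
    forall uv, ball_pairs R n uv ->
      deviation rho w uv / n%:R <= deviation rho w xy / n%:R.
Proof.
set F := fun xy => deviation rho w xy / n%:R.
have b0 : ball_pairs R n (0, 0).
  by rewrite /ball_pairs /= /enorm /toR2 map_mx0 big1 ?sqrtr0 // => k _;
     rewrite mxE expr0n.
have fin := finite_ball_pairs R n.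
pose s := fset_set (ball_pairs R n).
have sE xy : (xy \in s) = (xy \in ball_pairs R n) by rewrite in_fset_set.
have [xy xyB hmax] : exists2 xy, ball_pairs R n xy &
    forall uv, ball_pairs R n uv -> F uv <= F xy.
  have h0 : (0, 0) \in s by rewrite sE; exact/mem_set.
  pose i0 : s := [` h0]%fset.
  case: (@arg_maxP _ _ _ i0 xpredT (fun i : s => F (val i)) isT) => i _ hi.
  exists (val i); first by apply/set_mem; rewrite -sE; exact: valP.
  move=> uv /mem_set; rewrite -sE => huv.
  exact: (hi [` huv]%fset isT).
exists xy => //; split=> //; apply/eqP; rewrite eq_le; apply/andP; split.
  apply: ge_sup; first by exists (F xy), xy.
  by move=> _ [uv uvB <-]; exact: hmax.
apply: ub_le_sup; last by exists xy.
by exists (F xy) => _ [uv uvB <-]; exact: hmax.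
Qed.

(* Main.v *)
(** The weights almost surely take values in a common compact interval of
    (0, oo), so clamping them to it changes nothing almost surely and makes
    [D] a stationary metric [d], everywhere comparable with the l1 distance.
    Put [rho x := inf_n E d(0, n x) / n], extended to a norm on the plane.

    The only ergodic-theoretic tool is a maximal inequality: for a nonnegative
    superadditive process [X] over one translation with [E X_n <= g n], the
    event that [X_n >= l n] for some [n > 0] has probability at most [g / l].
    Single translations need not be ergodic, but [d(z, z + n x)] and
    [d(0, n x)] differ by a bounded amount, so an event of positive probability
    about the growth rate along [x] has full probability up to an arbitrarily
    small change of the rate.
    - If [d(0, n x) >= c n] infinitely often with [c > rho x], the inequality for
      the Birkhoff sums of [d(0, m x)], which dominate [d(0, k m x)], contradicts
      [E d(0, m x) < c m] for a suitable [m].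
    - If [d(0, n x) <= c n] infinitely often with [c < rho x], the inequality for
      [L n - d(0, n x)], [L] large, contradicts [E d(0, n x) >= rho x n].
    Hence [d(0, n x) / n] tends to [rho x]. Applied to the indicator of the
    event that this convergence is still slow at scale [K], the maximal
    inequality yields a good origin [j x] with [j] close to [k], whence
    [d(k x, k y) / k] tends to [rho (y - x)] for all lattice points [x] and [y].
    By the Lipschitz property, finitely many such pairs control the whole ball
    of radius [n]. *)
From Pilot Require Import Defs.
From mathcomp Require Import all_boot all_order all_algebra.
From mathcomp Require Import finmap.
From mathcomp Require Import all_classical all_reals all_analysis.
From mathcomp Require Import measurable_realfun zify ring lra.
(* [sequences] also exports a lemma called [adjacent]. *)
Import Pilot.Defs.
Import Order.TTheory GRing.Theory Num.Theory.
Import numFieldNormedType.Exports.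
Local Open Scope classical_set_scope.
Local Open Scope ring_scope.

Set Implicit Arguments.
Unset Strict Implicit.

(** * The metric [D] *)

Section L1.
Variable R : realType.
Implicit Types (u v : 'rV[R]_2) (x y : Z2).

Definition l1 u : R := `|u 0 0| + `|u 0 1|.

Lemma l1_ge0 u : 0 <= l1 u.
Proof. exact: addr_ge0. Qed.

Lemma l1_eq0 u : l1 u = 0 -> u = 0.
Proof.
move/eqP; rewrite paddr_eq0// !normr_eq0 => /andP[/eqP u0 /eqP u1].
by apply/rowP => k; rewrite mxE; case: (ord2P k) => ->.
Qed.

Lemma l1_0 : l1 0 = 0.
Proof. by rewrite /l1 !mxE normr0 addr0. Qed.

Lemma l1D u v : l1 (u + v) <= l1 u + l1 v.
Proof. by rewrite /l1 !mxE addrACA lerD// ler_normD. Qed.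

Lemma l1Z c u : l1 (c *: u) = `|c| * l1 u.
Proof. by rewrite /l1 !mxE !normrM mulrDr. Qed.

Lemma l1N u : l1 (- u) = l1 u.
Proof. by rewrite -scaleN1r l1Z normrN1 mul1r. Qed.

Lemma toR2_0 : toR2 R 0 = 0.
Proof. exact: raddf0. Qed.

Lemma toR2D x y : toR2 R (x + y) = toR2 R x + toR2 R y.
Proof. exact: raddfD. Qed.

Lemma toR2N x : toR2 R (- x) = - toR2 R x.
Proof. exact: raddfN. Qed.

Lemma toR2B x y : toR2 R (x - y) = toR2 R x - toR2 R y.
Proof. exact: raddfB. Qed.

Lemma toR2MN x n : toR2 R (x *+ n) = n%:R *: toR2 R x.
Proof. by rewrite scaler_nat; exact: raddfMn. Qed.

Lemma l1_toR2 x : l1 (toR2 R x) = (`|x 0 0| + `|x 0 1|)%:~R.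
Proof. by rewrite /l1 !mxE rmorphD /= !intr_norm. Qed.

End L1.

(** * Walks on the dual lattice and the triangle inequality *)

Section Paths.
Variables (R : realType) (w : weights R).
Implicit Types (x y z : Z2) (p q : seq Z2).

Lemma adjacent_sym x y : adjacent x y = adjacent y x.
Proof. by rewrite !adjacentE distrC [X in _ + X]distrC. Qed.

Lemma adjacentD x y z : adjacent (x + z) (y + z) = adjacent x y.
Proof. have shiftK (u v c : int) : u + c - (v + c) = u - v by lia.
by rewrite !adjacentE !mxE !shiftK. Qed.

Lemma path_adjacentD x p z :
  path adjacent (x + z) [seq y + z | y <- p] = path adjacent x p.
Proof. by elim: p x => //= y p IHp x; rewrite adjacentD IHp. Qed.

Lemma path_length_nil x : path_length w x [::] = 0.
Proof. by rewrite /path_length big_nil. Qed.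

Lemma path_length_cons x y p :
  path_length w x (y :: p) = weight (dual_edge x y) w + path_length w y p.
Proof. by rewrite /path_length /= big_cons. Qed.

Lemma path_length_cat x p q :
  path_length w x (p ++ q) = path_length w x p + path_length w (last x p) q.
Proof. by rewrite /path_length pairmap_cat big_cat. Qed.

Lemma path_length_ge0 x p : 0 <= path_length w x p.
Proof. by apply: sumr_ge0 => e _; rewrite /weight. Qed.

(** Weights are positive, so cutting out loops never lengthens a walk. Arbitrary walks, in
    particular concatenations, thus become competitors in the infimum over self-avoiding paths. *)
Lemma loop_erasure x p : path adjacent x p ->
  exists2 q, Gamma x (last x p) q & path_length w x q <= path_length w x p.
Proof.
elim: p x => [|y p IHp] x /=; first by exists [::].
move=> /andP[xy /IHp[q [qp qu ql] le_qp]].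
have [xq|xq] := boolP (x \in y :: q); last first.
  exists (y :: q); last by rewrite !path_length_cons lerD2l.
  by split; rewrite /= ?xy//; apply/andP; split.
case/splitPl: xq qp qu ql le_qp => q1 q2 q1x.
rewrite cat_path last_cat -cat_cons cat_uniq q1x path_length_cat q1x.
move=> /andP[_ q2p] /and3P[_ q12 q2u] q2l le_q12; exists q2; first split => //.
- rewrite /= q2u andbT; apply/negP => xq2.
  by move/hasPn: q12 => /(_ _ xq2)/=; rewrite -{1}q1x mem_last.
- rewrite path_length_cons (le_trans _ (le_trans le_q12 _))//.
    by rewrite lerDr path_length_ge0.
  by rewrite lerDr /weight.
Qed.

Lemma path_reversal x p : path adjacent x p ->
  exists q, [/\ path adjacent (last x p) q, last (last x p) q = x,
    size q = size p & path_length w (last x p) q = path_length w x p].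
Proof.
elim: p x => [|y p IHp] x /=; first by exists [::].
move=> /andP[xy /IHp[q [qp ql qs qE]]]; exists (rcons q x).
rewrite rcons_path last_rcons size_rcons qs qp ql adjacent_sym xy -cats1 path_length_cat.
rewrite ql qE !path_length_cons path_length_nil addr0 dual_edgeC.
by split=> //; rewrite addrC.
Qed.

Lemma has_lbound_path_lengths x y :
  has_lbound [set path_length w x p | p in Gamma x y].
Proof. by exists 0 => _ [p _ <-]; exact: path_length_ge0. Qed.

Lemma D_le_walk x p : path adjacent x p -> D w x (last x p) <= path_length w x p.
Proof.
move=> /loop_erasure[q qG le_qp]; apply: le_trans le_qp.
by apply: ge_inf; [exact: has_lbound_path_lengths|exists q].
Qed.

Lemma straight_walk (k : 'I_2) n x : exists p,
  [/\ path adjacent x p, last x p = x + n%:Z *: delta_mx 0 k & size p = n].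
Proof.
elim: n x => [|n IHn] x; first by exists [::]; rewrite /= scale0r addr0.
have [p [xp lp sp]] := IHn (x + delta_mx 0 k); exists (x + delta_mx 0 k :: p).
rewrite /= lp sp xp andbT -addrA intS scalerDl scale1r; split=> //.
by rewrite adjacentE !mxE !eqxx /=; case: (ord2P k) => -> /=; lia.
Qed.

(** A segment along each coordinate in turn; segments in a negative direction are reversals of
    positive ones. *)
Lemma geodesic_exists x y : exists p, [/\ path adjacent x p, last x p = y &
  (size p)%:Z = `|x 0 0 - y 0 0| + `|x 0 1 - y 0 1|].
Proof.
have line (k : 'I_2) (n : int) z : exists p, [/\ path adjacent z p,
    last z p = z + n *: delta_mx 0 k & size p = `|n|%N].
  have [n0|n0] := leP 0 n.
    by have := straight_walk k `|n|%N z; rewrite gez0_abs.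
  have [p []] := straight_walk k `|n|%N (z + n *: delta_mx 0 k).
  rewrite ltz0_abs// scaleNr addrK => /path_reversal+ lp sp.
  rewrite lp => -[q [qp ql qs _]].
  by exists q; rewrite qs sp.
have [p [pp pl ps]] := line 0 ((y - x) 0 0) x.
have [q [qp ql qs]] := line 1 ((y - x) 0 1) (last x p).
exists (p ++ q); split.
- by rewrite cat_path pp.
- rewrite last_cat ql pl; apply/rowP => k.
  by case: (ord2P k) => ->; rewrite !mxE /=; lia.
- rewrite size_cat ps qs PoszD !abszE !mxE distrC; congr (_ + _).
  by rewrite distrC.
Qed.

(** The l1 geodesic, with loops erased, shows that [Gamma x y] is nonempty, so that [D] is a true
    infimum and not the default value of [inf]. *)
Lemma has_inf_path_lengths x y :
  has_inf [set path_length w x p | p in Gamma x y].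
Proof.
split; last exact: has_lbound_path_lengths.
have [p [/loop_erasure[q qG _] ly _]] := geodesic_exists x y.
by exists (path_length w x q), q; rewrite // -ly.
Qed.

Lemma D_adherent x y (e : R) : 0 < e ->
  exists p, [/\ path adjacent x p, last x p = y & path_length w x p < D w x y + e].
Proof.
move=> e0; have [_ [p [pp _ pl] <-] lt_p] :=
  inf_adherent e0 (has_inf_path_lengths x y).
by exists p.
Qed.

Lemma D_triangle y x z : D w x z <= D w x y + D w y z.
Proof.
apply/ler_addgt0Pr => e e0; have e2 : 0 < e / 2 by rewrite divr_gt0.
have [p [pp pl lt_p]] := D_adherent x y e2.
have [q [qp ql lt_q]] := D_adherent y z e2.
have pq : path adjacent x (p ++ q) by rewrite cat_path pp pl.
have := D_le_walk pq; rewrite last_cat path_length_cat pl ql; lra.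
Qed.

Lemma D_sym x y : D w x y = D w y x.
Proof.
suff le_D u v : D w u v <= D w v u by apply/eqP; rewrite eq_le !le_D.
apply/ler_addgt0Pr => e e0; have [p [pp pl lt_p]] := D_adherent v u e0.
have [q []] := path_reversal pp; rewrite pl => qp ql _ qE.
by have := D_le_walk qp; rewrite ql qE => /le_trans; apply; exact: ltW.
Qed.

Lemma path_length_ge (a : R) x p : (forall e, a <= weight e w) ->
  a *+ size p <= path_length w x p.
Proof.
move=> aw; elim: p x => [|y p IHp] x; first by rewrite path_length_nil.
by rewrite path_length_cons mulrS lerD.
Qed.

Lemma path_length_le (b : R) x p : (forall e, weight e w <= b) ->
  path_length w x p <= b *+ size p.
Proof.
move=> wb; elim: p x => [|y p IHp] x; first by rewrite path_length_nil.
by rewrite path_length_cons mulrS lerD.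
Qed.

Lemma size_walk_ge x p : path adjacent x p ->
  `|x 0 0 - last x p 0 0| + `|x 0 1 - last x p 0 1| <= (size p)%:Z.
Proof.
elim: p x => [|y p IHp] x /=; first by rewrite !subrr.
by rewrite adjacentE => /andP[/eqP xy /IHp]; lia.
Qed.

End Paths.

Lemma dual_edgeD (x y z : Z2) :
  dual_edge (x + z) (y + z) = ((dual_edge x y).1 + z, (dual_edge x y).2).
Proof.
rewrite /dual_edge /=; congr pair; last by rewrite !mxE (inj_eq (addIr _)).
by apply/rowP => k; rewrite !mxE addr_maxl.
Qed.

(** * Equivariance of [D] under translations *)

Section Translation.
Variable R : realType.
Implicit Types (w : weights R) (x y z : Z2).

Lemma translateD y z w : translate y (translate z w) = translate (y + z) w.
Proof. by apply/funext => -[v k]; rewrite /translate /= addrA. Qed.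

Lemma translate0 w : translate 0 w = w.
Proof. by apply/funext => -[v k]; rewrite /translate /= addr0. Qed.

Lemma path_length_translate z w x p : path_length (translate z w) x p =
  path_length w (x + z) [seq y + z | y <- p].
Proof.
elim: p x => [|y p IHp] x; first by rewrite /= !path_length_nil.
by rewrite /= !path_length_cons IHp dual_edgeD.
Qed.

Lemma D_translate z w x y : D (translate z w) x y = D w (x + z) (y + z).
Proof.
have le_D (u v : weights R) (a b c : Z2) : u = translate c v ->
      D u a b <= D v (a + c) (b + c).
  move=> ->; apply/ler_addgt0Pr => e e0.
  have [p [pp pl lt_p]] := D_adherent v (a + c) (b + c) e0.
  pose q := [seq y - c | y <- p].
  have qK : [seq y + c | y <- q] = p.
    by rewrite -map_comp map_id_in// => ? _ /=; rewrite subrK.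
  have qp : path adjacent a q by rewrite -(path_adjacentD a q c) qK.
  have ql : last a q = b.
    by apply: (addIr c); rewrite -pl -qK (last_map (fun y => y + c)).
  have := D_le_walk (translate c v) qp.
  by rewrite ql path_length_translate qK => /le_trans; apply; exact: ltW.
apply/eqP; rewrite eq_le le_D//=.
have := le_D w (translate z w) (x + z) (y + z) (- z).
by rewrite !addrK; apply; rewrite translateD addNr translate0.
Qed.

End Translation.

Section Bounds.
Variables (R : realType) (w : weights R).
Implicit Types (x y : Z2).

Lemma D_le_l1 (b : R) x y : (forall e, weight e w <= b) ->
  D w x y <= b * l1 (toR2 R (x - y)).
Proof.
move=> /path_length_le wb; have [p [pp pl ps]] := geodesic_exists w x y.
rewrite -{1}pl (le_trans (D_le_walk w pp))// (le_trans (wb _ _))//.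
by rewrite l1_toR2 !mxE -ps mulr_natr.
Qed.

Lemma D_ge_l1 (a : R) x y : 0 <= a -> (forall e, a <= weight e w) ->
  a * l1 (toR2 R (x - y)) <= D w x y.
Proof.
move=> a0 /path_length_ge aw.
apply: lb_le_inf; first by have [] := has_inf_path_lengths w x y.
move=> _ [p [pp _ pl] <-]; apply: le_trans (aw _ _).
rewrite -[leRHS]mulr_natr ler_wpM2l// l1_toR2 !mxE -pl.
by rewrite -[(size p)%:R]/((size p)%:Z%:~R) ler_int; exact: size_walk_ge.
Qed.

End Bounds.

(** * Truncated weights *)

Section Clamp.
Variables (R : realType) (a b : {posnum R}).

Definition clamp (w : weights R) : weights R :=
  fun e => (Num.max a%:num (Num.min b%:num (w e)%:num))%:pos.

Lemma weight_clamp e w :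
  weight e (clamp w) = Num.max a%:num (Num.min b%:num (weight e w)).
Proof. by []. Qed.

Lemma clamp_id w : (forall e, a%:num <= weight e w <= b%:num) -> clamp w = w.
Proof.
move=> wab; apply/funext => e; apply/val_inj; rewrite /= /clamp /=.
by have /andP[? ?] := wab e; rewrite min_r// max_r.
Qed.

(** [D < c] holds exactly when one of the countably many walks from [x] to [y] is shorter than [c],
    and each length is a finite sum of measurable functions. Loops are harmless by [D_le_walk]. *)
Lemma measurable_D_clamp x y :
  measurable_fun setT (fun w : weights R => D (clamp w) x y).
Proof.
move=> mT; apply: (measurability _ (RGenInftyO.measurableE R)) => //.
move=> _ [_ [c ->] <-]; rewrite setTI.
have mlen z p : measurable_fun setT (fun w => path_length (clamp w) z p).
  elim: p z => [|v p IHp] z.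
    by under eq_fun do rewrite path_length_nil; exact: measurable_cst.
  under eq_fun do rewrite path_length_cons weight_clamp.
  apply: measurable_funD => //; apply: measurable_maxr => //.
  by apply: measurable_minr => //; exact: measurable_weight.
rewrite (_ : _ @^-1` _ = \bigcup_(p : seq Z2)
  if path adjacent x p && (last x p == y)
  then (fun w => path_length (clamp w) x p) @^-1` `]-oo, c[ else set0).
  apply: countable_bigcupT_measurable => [|p]; first exact: countableP.
  by case: ifP => // _; rewrite -[X in measurable X]setTI; exact: mlen.
apply/seteqP; split=> w /=.
  rewrite in_itv /= -subr_gt0 => /(@D_adherent _ (clamp w) x y _)[p [pp pl lt_p]].
  exists p => //; rewrite pp pl eqxx /= in_itv /=.
  by rewrite addrC subrK in lt_p.
move=> [p _]; case: ifP => // /andP[pp /eqP pl] /=.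
by rewrite !in_itv /= -{1}pl; apply: le_lt_trans; exact: D_le_walk.
Qed.

End Clamp.

(** * Ergodic theory of translations *)

Lemma measurable_translate (R : realType) (z : Z2) :
  measurable_fun setT (@translate R z : weights R -> weights R).
Proof.
apply: (@measurability _ _ (weights R) (weights R) _ _ (cylinders R)) => //.
move=> _ [_ [e [B [mB ->]]] <-].
rewrite setTI; apply: sub_sigma_algebra.
by exists (e.1 + z, e.2), B; split.
Qed.

Lemma measurable_superlevel d (T : measurableType d) (R : realType) (c : R)
    (f : T -> R) : measurable_fun setT f -> measurable [set w | c <= f w].
Proof.
move=> /(_ measurableT _ (measurable_itv `[c, +oo[)); rewrite setTI.
by congr measurable; apply/seteqP; split=> w /=; rewrite in_itv /= andbT.
Qed.

Lemma measurable_sublevel d (T : measurableType d) (R : realType) (c : R)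
    (f : T -> R) : measurable_fun setT f -> measurable [set w | f w <= c].
Proof.
move=> /(_ measurableT _ (measurable_itv `]-oo, c])); rewrite setTI.
by congr measurable; apply/seteqP; split=> w /=; rewrite in_itv.
Qed.

(** * Real-valued probabilities and expectations *)

Section Probability.
Variables (R : realType) (P : probability (weights R) R).
Implicit Types (f g : weights R -> R) (A : set (weights R)) (z : Z2).

Definition Pr A : R := fine (P A).

Lemma EFin_Pr A : measurable A -> (Pr A)%:E = P A.
Proof. by move=> mA; rewrite fineK// fin_num_measure. Qed.

Lemma Pr_ge0 A : 0 <= Pr A.
Proof. exact: fine_ge0. Qed.

Lemma le_Pr A B : measurable A -> measurable B -> A `<=` B -> Pr A <= Pr B.
Proof.
by move=> mA mB AB; rewrite -lee_fin !EFin_Pr// le_measure ?inE.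
Qed.

Lemma Pr_nondecreasing_cvg (A : nat -> set (weights R)) :
  (forall n, measurable (A n)) -> nondecreasing_seq A ->
  Pr (A n) @[n --> \oo] --> Pr (\bigcup_n A n).
Proof.
move=> mA ndA; apply: fine_cvg.
rewrite EFin_Pr; last exact: bigcupT_measurable.
by apply: nondecreasing_cvg_mu => //; exact: bigcupT_measurable.
Qed.

Lemma Pr_nonincreasing_cvg (A : nat -> set (weights R)) :
  (forall n, measurable (A n)) -> nonincreasing_seq A ->
  Pr (A n) @[n --> \oo] --> Pr (\bigcap_n A n).
Proof.
move=> mA ndA; apply: fine_cvg.
rewrite EFin_Pr; last exact: bigcapT_measurable.
apply: nonincreasing_cvg_mu => //; last exact: bigcapT_measurable.
exact: le_lt_trans (probability_le1 P (mA _)) (ltry 1).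
Qed.

Definition bounded_mfun f :=
  measurable_fun setT f /\ exists M, forall w, `|f w| <= M.

Definition Ex f : R := \int[P]_w f w.

Lemma bounded_mfun_integrable f : bounded_mfun f ->
  P.-integrable setT (EFin \o f).
Proof.
move=> [mf [M fM]]; apply: measurable_bounded_integrable => //.
  exact: le_lt_trans (probability_le1 P measurableT) (ltry 1).
exists M; split; first exact: num_real.
by move=> N MN w _ /=; rewrite (le_trans (fM w))// ltW.
Qed.

Lemma bounded_mfun_cst (c : R) : bounded_mfun (cst c).
Proof. by split; [exact: measurable_cst|exists `|c|]. Qed.

Lemma bounded_mfunD f g : bounded_mfun f -> bounded_mfun g ->
  bounded_mfun (fun w => f w + g w).
Proof.
move=> [mf [M fM]] [mg [N gN]]; split; first exact: measurable_funD.
by exists (M + N) => w; rewrite (le_trans (ler_normD _ _))// lerD.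
Qed.

Lemma bounded_mfunN f : bounded_mfun f -> bounded_mfun (fun w => - f w).
Proof.
move=> [mf [M fM]]; split; first exact: measurableT_comp.
by exists M => w; rewrite normrN.
Qed.

Lemma bounded_mfun_translate f z : bounded_mfun f ->
  bounded_mfun (fun w => f (translate z w)).
Proof.
move=> [mf [M fM]]; split; last by exists M.
by apply: (measurableT_comp mf); exact: measurable_translate.
Qed.

Lemma bounded_mfun_indic A : measurable A -> bounded_mfun (\1_A).
Proof.
move=> mA; split; first exact: measurable_indic.
by exists 1 => w; rewrite indicE; case: (_ \in _); rewrite ?normr1 ?normr0.
Qed.

Lemma Ex_cst (c : R) : Ex (cst c) = c.
Proof.
rewrite /Ex Rintegral_cst// [X in fine X](_ : _ = 1%E) ?mulr1//.
exact: probability_setT.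
Qed.

Lemma ExD f g : bounded_mfun f -> bounded_mfun g ->
  Ex (fun w => f w + g w) = Ex f + Ex g.
Proof. by move=> bf bg; apply: RintegralD => //; exact: bounded_mfun_integrable. Qed.

Lemma ExB f g : bounded_mfun f -> bounded_mfun g ->
  Ex (fun w => f w - g w) = Ex f - Ex g.
Proof. by move=> bf bg; apply: RintegralB => //; exact: bounded_mfun_integrable. Qed.

Lemma ExZ (c : R) f : bounded_mfun f -> Ex (fun w => c * f w) = c * Ex f.
Proof. by move=> bf; apply: RintegralZl => //; exact: bounded_mfun_integrable. Qed.

Lemma le_Ex f g : bounded_mfun f -> bounded_mfun g ->
  (forall w, f w <= g w) -> Ex f <= Ex g.
Proof.
by move=> bf bg fg; apply: le_Rintegral => //; exact: bounded_mfun_integrable.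
Qed.

Lemma Ex_indic A : measurable A -> Ex (\1_A) = Pr A.
Proof. by move=> mA; rewrite /Ex /Rintegral integral_indic// setIT. Qed.

Hypothesis statP : stationary P.

Lemma Ex_translate z f : bounded_mfun f -> Ex (fun w => f (translate z w)) = Ex f.
Proof.
move=> bf; congr fine.
have mt := @measurable_translate R z.
transitivity (\int[pushforward P (translate z)]_w (f w)%:E)%E.
  rewrite integral_pushforward//= ?preimage_setT//.
  - by apply/measurable_EFinP; case: bf.
  - exact: (bounded_mfun_integrable (bounded_mfun_translate z bf)).
by apply: eq_measure_integral => A mA _; exact: statP.
Qed.

Definition birkhoff_sum z f n (w : weights R) : R :=
  \sum_(j < n) f (translate (z *+ j) w).

Lemma bounded_mfun_birkhoff z f n : bounded_mfun f ->
  bounded_mfun (birkhoff_sum z f n).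
Proof.
move=> bf; elim: n => [|n IHn]; rewrite /birkhoff_sum.
  by under eq_fun do rewrite big_ord0; exact: bounded_mfun_cst.
under eq_fun do rewrite big_ord_recr.
by apply: bounded_mfunD => //; exact: bounded_mfun_translate.
Qed.

Lemma Ex_birkhoff z f n : bounded_mfun f ->
  Ex (birkhoff_sum z f n) = Ex f *+ n.
Proof.
move=> bf; elim: n => [|n IHn]; rewrite /birkhoff_sum.
  by under eq_fun do rewrite big_ord0; rewrite Ex_cst.
under eq_fun do rewrite big_ord_recr.
rewrite ExD ?Ex_translate ?IHn ?mulrSr//.
- exact: bounded_mfun_birkhoff.
- exact: bounded_mfun_translate.
Qed.

Lemma birkhoff_sumD z f m n w : birkhoff_sum z f (m + n) w =
  birkhoff_sum z f m w + birkhoff_sum z f n (translate (z *+ m) w).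
Proof.
rewrite /birkhoff_sum big_split_ord /=; congr (_ + _).
by apply: eq_bigr => j _; rewrite translateD -mulrnDr addnC.
Qed.

(** * A maximal inequality for superadditive processes *)

Section MaximalInequality.
Variables (z : Z2) (X : nat -> weights R -> R) (l g : R).
Hypothesis bX : forall n, bounded_mfun (X n).
Hypothesis X_ge0 : forall n w, 0 <= X n w.
Hypothesis X_superadditive : forall m n w,
  X m w + X n (translate (z *+ m) w) <= X (m + n)%N w.
Hypothesis l_ge0 : 0 <= l.
Hypothesis Ex_X : forall n, Ex (X n) <= g *+ n.

(** Bounding the waiting time by [M] ensures that windows opened before time [N] close by time
    [N + M]. *)
Let A (M : nat) := [set w | exists2 n, (0 < n <= M)%N & l *+ n <= X n w].

Let mA M : measurable (A M).
Proof.
have -> : A M = \bigcup_(n in [set n | (0 < n <= M)%N]) [set w | l *+ n <= X n w].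
  by apply/seteqP; split=> w [n nM lX]; exists n.
apply: bigcup_measurable => n _.
by apply: measurable_superlevel; case: (bX n).
Qed.

(* A visit to [A M] at time [j] opens a window [j, j + n) with [n <= M] on
   which [X] gains at least [l * n]; the windows are chosen greedily. *)
Let cover M N w : l * birkhoff_sum z (\1_(A M)) N w <= X (N + M) w.
Proof.
elim/ltn_ind: N w => -[|N] IHN w; first by rewrite /birkhoff_sum big_ord0 mulr0.
have [[n /andP[n_gt0 nM] lX]|nA] := pselect (A M w); last first.
  rewrite -{1}add1n birkhoff_sumD {1}/birkhoff_sum big_ord1 mulr0n translate0.
  rewrite indicE memNset// add0r (le_trans (IHN _ _ _))//.
  by rewrite (le_trans _ (X_superadditive 1 (N + M) w))// lerDr.
have ind_le1 m v : birkhoff_sum z (\1_(A M)) m v <= m%:R.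
  by rewrite -[m in leRHS]card_ord -sumr_const ler_sum.
have le_n m : (m <= n)%N -> l * birkhoff_sum z (\1_(A M)) m w <= X n w.
  move=> mn; apply: le_trans lX; rewrite -mulr_natr ler_wpM2l//.
  by rewrite (le_trans (ind_le1 _ _))// ler_nat.
have [nN|Nn] := leqP n N.+1.
  have -> : N.+1 = (n + (N.+1 - n))%N by rewrite subnKC.
  rewrite birkhoff_sumD mulrDr -addnA (le_trans _ (X_superadditive _ _ _))//.
  by rewrite lerD ?le_n// IHN//; lia.
(* The window outlasts the horizon: it alone pays for all remaining visits, and [n <= M] keeps it
   before [N.+1 + M]. *)
have -> : (N.+1 + M = n + (N.+1 + M - n))%N by lia.
rewrite (le_trans _ (X_superadditive _ _ _))//.
by rewrite (le_trans (le_n _ (ltnW Nn)))// lerDl.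
Qed.

(** Integrating [cover] gives [l * Pr (A M) * N <= g * (N + M)]. Letting [N] and then [M] tend to
    infinity removes the boundary term and the bound on the waiting time. *)
Lemma maximal_inequality :
  l * Pr [set w | exists2 n, (0 < n)%N & l *+ n <= X n w] <= g.
Proof.
have PrA M : l * Pr (A M) <= g.
  apply/ler_addgt0Pr => e e0.
  have le_g N : (l * Pr (A M) - g) *+ N <= g *+ M.
    rewrite mulrnBl lerBlDr -mulrnDr addnC -mulrnAr -(Ex_indic (mA M)).
    have bA := bounded_mfun_indic (mA M).
    rewrite -(Ex_birkhoff z _ bA) (le_trans _ (Ex_X _))//.
    have bB := bounded_mfun_birkhoff z N bA.
    rewrite -ExZ//; apply: le_Ex => //.
    split; first by apply: measurable_funM => //; case: bB.
    by case: bB => _ [K BK]; exists (l * K) => w;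
      rewrite normrM (ger0_norm l_ge0) ler_wpM2l.
  rewrite -lerBlDl leNgt; apply/negP => e_lt.
  have := archi_boundP (normr_ge0 ((g *+ M) / e)).
  set N := Num.bound _; apply/negP; rewrite -leNgt.
  have := le_trans (ler_wMn2r N (ltW e_lt)) (le_g N).
  by rewrite -[e *+ N]mulr_natl => le_eN; rewrite (le_trans _ (ler_norm _))// ler_pdivlMr.
have -> : [set w | exists2 n, (0 < n)%N & l *+ n <= X n w] = \bigcup_M A M.
  apply/seteqP; split=> [w [n n0 lX]|w [M _ [n /andP[n0 _] lX]]].
    by exists n => //; exists n => //; rewrite n0 leqnn.
  by exists n.
have ndA : nondecreasing_seq A.
  move=> M N MN; apply/subsetPset => w [n /andP[n0 nM] lX].
  by exists n => //; rewrite n0 (leq_trans nM).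
have Pr_cvg : l * Pr (A M) @[M --> \oo] --> l * Pr (\bigcup_M A M).
  by apply: cvgM; [exact: cvg_cst|exact: Pr_nondecreasing_cvg].
by apply: (cvgr_to_le Pr_cvg); exact: nearW.
Qed.

End MaximalInequality.

(** * Ergodicity under all translations *)

Hypothesis ergP : ergodic P.

(** The union of all translates of [A] is invariant under every translation and has positive
    probability, hence probability one, and it lies in [B]. In the applications [B] is a weaker form
    of [A] that survives a change of origin. *)
Lemma ergodic_orbit A B : measurable A -> measurable B -> 0 < Pr A ->
  (forall z w, A (translate z w) -> B w) -> Pr B = 1.
Proof.
move=> mA mB PrA AB; apply/eqP; rewrite eq_le; apply/andP; split.
  by rewrite -lee_fin EFin_Pr// probability_le1.
pose U := \bigcup_z (translate z @^-1` A).
have mU : measurable U.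
  apply: countable_bigcupT_measurable => [|z]; first exact: countableP.
  by rewrite -[X in measurable X]setTI; exact: measurable_translate.
have AU : A `<=` U by move=> w Aw; exists 0; rewrite //= translate0.
have UB : U `<=` B by move=> w [z _]; exact: AB.
apply: le_trans (le_Pr mU mB UB).
have /ergP[|U0|U1] := mU; last by rewrite /Pr U1.
  move=> z; apply/seteqP; split=> w [y _] /=.
    by rewrite translateD; exists (y + z).
  by move=> Ay; exists (y - z); rewrite //= translateD subrK.
have := lt_le_trans PrA (le_Pr mA mU AU).
by rewrite /Pr U0 ltxx.
Qed.

End Probability.

Section AlmostEverywhere.
Variables (R : realType) (P : probability (weights R) R).

Lemma ae_Pr1 (A : set (weights R)) : measurable A -> P A = 1%E ->
  {ae P, forall w, A w}.
Proof.
move=> mA PA; exists (~` A); split=> //; first exact: measurableC.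
by rewrite probability_setC// PA subee.
Qed.

Lemma ae_Pr0C (A : set (weights R)) : measurable A -> Pr P A = 0 ->
  {ae P, forall w, ~ A w}.
Proof.
move=> mA PA; apply: ae_Pr1; first exact: measurableC.
by rewrite probability_setC// -EFin_Pr// PA sube0.
Qed.

Lemma ae_forall_countable (T : countType) (Q : T -> weights R -> Prop) :
  (forall t, {ae P, forall w, Q t w}) -> {ae P, forall w, forall t, Q t w}.
Proof.
move=> aeQ; pose Q' n w := if choice.unpickle n is Some t then Q t w else True.
have : {ae P, forall w, forall n, Q' n w}.
  by apply: ae_foralln => n; rewrite /Q'; case: choice.unpickle => [t|]; last exact: aeW.
by apply: filterS => w Qw t; have := Qw (choice.pickle t); rewrite /Q' choice.pickleK.
Qed.

End AlmostEverywhere.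

(** * Scaling limits of a stationary metric *)

(** Archimedean principle, applied in [rhoZ_ge0] to pass from integer to real homogeneity. *)
Lemma bounded_multiples_le0 (R : realType) (x c : R) :
  (forall n, x *+ n <= c) -> x <= 0.
Proof.
move=> xc; rewrite leNgt; apply/negP => x0.
have := xc (Num.truncn (c / x)).+1; apply/negP; rewrite -ltNge.
by rewrite -mulr_natl -ltr_pdivrMr// truncnS_gt.
Qed.

Section StationaryMetric.
Variables (R : realType) (P : probability (weights R) R).
Hypotheses (statP : stationary P) (ergP : ergodic P).
Variables (d : weights R -> Z2 -> Z2 -> R) (a b : R).
Hypothesis a_gt0 : 0 < a.
Hypothesis b_gt0 : 0 < b.
Hypothesis measurable_d : forall x y, measurable_fun setT (fun w => d w x y).
Hypothesis d_ge_l1 : forall w x y, a * l1 (toR2 R (x - y)) <= d w x y.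
Hypothesis d_le_l1 : forall w x y, d w x y <= b * l1 (toR2 R (x - y)).
Hypothesis d_triangle : forall w y x z, d w x z <= d w x y + d w y z.
Hypothesis d_sym : forall w x y, d w x y = d w y x.
Hypothesis d_translate : forall z w x y,
  d (translate z w) x y = d w (x + z) (y + z).
Implicit Types (x y z : Z2) (u v : 'rV[R]_2).
Local Notation Pr := (Pr P).
Local Notation Ex := (Ex P).

Let l1B u v : l1 (u - v) = l1 (v - u).
Proof. by rewrite -l1N opprB. Qed.

Lemma d_ge0 w x y : 0 <= d w x y.
Proof. by rewrite (le_trans _ (d_ge_l1 _ _ _))// mulr_ge0 ?l1_ge0 ?ltW. Qed.

Lemma d_lipschitz w x y x' y' :
  `|d w x y - d w x' y'| <= b * (l1 (toR2 R (x - x')) + l1 (toR2 R (y - y'))).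
Proof.
have le_d p q r s :
    d w p q <= d w r s + b * (l1 (toR2 R (p - r)) + l1 (toR2 R (q - s))).
  have := d_triangle w r p q; have := d_triangle w s r q.
  have := d_le_l1 w p r; have := d_le_l1 w s q.
  by rewrite !toR2B (l1B (toR2 R s)); lra.
rewrite ler_norml; have := le_d x y x' y'; have := le_d x' y' x y.
by rewrite !toR2B (l1B (toR2 R x') _) (l1B (toR2 R y') _); lra.
Qed.

Lemma bounded_d x y : bounded_mfun (fun w => d w x y).
Proof.
split; first exact: measurable_d.
exists (b * l1 (toR2 R (x - y))) => w.
by rewrite ger0_norm ?d_ge0 ?d_le_l1.
Qed.

(** * Expected distances and the norm they define *)

Definition phi x : R := Ex (fun w => d w 0 x).

Lemma Ex_d z x : Ex (fun w => d w z (x + z)) = phi x.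
Proof.
rewrite /phi -(Ex_translate statP z (bounded_d 0 x)); congr (Ex _).
by apply/funext => w; rewrite d_translate add0r.
Qed.

(** By stationarity the second leg, which starts at [x], has the same mean length as one that starts
    at 0. *)
Lemma phiD x y : phi (x + y) <= phi x + phi y.
Proof.
rewrite -[phi y](Ex_d x) -ExD; try exact: bounded_d.
apply: le_Ex => [||w]; first exact: bounded_d.
- by apply: bounded_mfunD; exact: bounded_d.
- by rewrite (addrC x); exact: d_triangle.
Qed.

Lemma phiN x : phi (- x) = phi x.
Proof.
rewrite -[LHS](Ex_d x) addNr; congr (Ex _).
by apply/funext => w; rewrite d_sym.
Qed.

Lemma phi_le_l1 x : phi x <= b * l1 (toR2 R x).
Proof.
rewrite -[leRHS](Ex_cst P) le_Ex//; [exact: bounded_d|exact: bounded_mfun_cst|].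
by move=> w /=; rewrite (le_trans (d_le_l1 _ _ _))// sub0r toR2N l1N.
Qed.

Lemma phi_ge_l1 x : a * l1 (toR2 R x) <= phi x.
Proof.
rewrite -[leLHS](Ex_cst P) le_Ex//; [exact: bounded_mfun_cst|exact: bounded_d|].
by move=> w /=; rewrite (le_trans _ (d_ge_l1 _ _ _))// sub0r toR2N l1N.
Qed.

Lemma phi0 : phi 0 = 0.
Proof.
have := phi_le_l1 0; have := phi_ge_l1 0.
by rewrite ?toR2_0 l1_0; lra.
Qed.

Lemma phiMn x n : phi (x *+ n) <= phi x *+ n.
Proof.
elim: n => [|n IHn]; first by rewrite mulr0n phi0.
by rewrite mulrS (le_trans (phiD _ _))// [leRHS]mulrS lerD2l.
Qed.

(* The infimal convolution with [b * l1] extends [phi] from the lattice to the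
   plane; the infimum over [n] is the one of Fekete's lemma. *)
Definition rho u : R := inf [set (phi nz.2 + b * l1 (nz.1%:R *: u - toR2 R nz.2))
  / nz.1%:R | nz in [set nz : nat * Z2 | (0 < nz.1)%N]].

Let rho_has_inf u : has_inf [set (phi nz.2 +
  b * l1 (nz.1%:R *: u - toR2 R nz.2)) / nz.1%:R
    | nz in [set nz : nat * Z2 | (0 < nz.1)%N]].
Proof.
split; first by eexists; exists (1%N, 0).
exists 0 => _ [[n z] /= n0 <-].
rewrite divr_ge0// addr_ge0 ?mulr_ge0 ?l1_ge0 ?(ltW b_gt0)//.
by rewrite (le_trans _ (phi_ge_l1 _))// mulr_ge0 ?l1_ge0 ?ltW.
Qed.

Lemma rho_le n z u : (0 < n)%N ->
  n%:R * rho u <= phi z + b * l1 (n%:R *: u - toR2 R z).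
Proof.
move=> n0; rewrite mulrC -ler_pdivlMr ?ltr0n//.
by apply: ge_inf; [case: (rho_has_inf u)|exists (n, z)].
Qed.

Lemma rho_ge c u : (forall n z, (0 < n)%N ->
  n%:R * c <= phi z + b * l1 (n%:R *: u - toR2 R z)) -> c <= rho u.
Proof.
move=> c_le; apply: lb_le_inf; first by case: (rho_has_inf u).
by move=> _ [[n z] /= n0 <-]; rewrite ler_pdivlMr ?ltr0n// mulrC c_le.
Qed.

Lemma rho_adherent c u : rho u < c -> exists n z, (0 < n)%N /\
  phi z + b * l1 (n%:R *: u - toR2 R z) < n%:R * c.
Proof.
rewrite -subr_gt0 => /inf_adherent/(_ (rho_has_inf u))[_ [[n z] /= n0 <-]].
rewrite [ltRHS]addrC subrK ltr_pdivrMr ?ltr0n// [ltRHS]mulrC => lt_c.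
by exists n, z.
Qed.

(** Since [a <= b], the penalty [b * l1] dominates the [a * l1] lost between [n u] and [z], so the
    lower bound on [phi] passes to [rho]. *)
Lemma rho_ge_l1 u : a * l1 u <= rho u.
Proof.
apply: rho_ge => n z n0.
have ab : a <= b.
  have := le_trans (d_ge_l1 point (delta_mx 0 0) 0) (d_le_l1 _ _ _).
  by rewrite subr0 /l1 !mxE /= normr0 normr1 addr0 !mulr1.
have -> : n%:R * (a * l1 u) = a * l1 (n%:R *: u - toR2 R z + toR2 R z).
  by rewrite subrK l1Z normr_nat mulrCA.
have := ler_wpM2l (ltW a_gt0) (l1D (n%:R *: u - toR2 R z) (toR2 R z)).
have := ler_wpM2r (l1_ge0 (n%:R *: u - toR2 R z)) ab.
have := phi_ge_l1 z; lra.
Qed.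

Lemma rho_le_l1 u : rho u <= b * l1 u.
Proof.
have := @rho_le 1 0 u isT.
by rewrite mul1r scale1r phi0 add0r toR2_0 subr0.
Qed.

Lemma rho0 : rho 0 = 0.
Proof.
have := rho_le_l1 0; have := rho_ge_l1 0.
by rewrite ?toR2_0 l1_0; lra.
Qed.

Lemma rho_ge0 u : 0 <= rho u.
Proof. by rewrite (le_trans _ (rho_ge_l1 u))// mulr_ge0 ?l1_ge0 ?ltW. Qed.

(** Almost optimal pairs [(n, x)] for [u] and [(m, y)] for [v] combine to the competitor
    [(n m, m x + n y)] for [u + v]. *)
Lemma rhoD u v : rho (u + v) <= rho u + rho v.
Proof.
apply/ler_addgt0Pr => e e0.
have lt_e p : rho p < rho p + e / 2 by rewrite ltrDl divr_gt0.
have [n [x [n0 xn]]] := rho_adherent (lt_e u).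
have [m [y [m0 ym]]] := rho_adherent (lt_e v).
have nm0 : (0 < n * m)%N by rewrite muln_gt0 n0.
have := rho_le (x *+ m + y *+ n) (u + v) nm0.
have -> : (n * m)%:R *: (u + v) - toR2 R (x *+ m + y *+ n) =
    m%:R *: (n%:R *: u - toR2 R x) + n%:R *: (m%:R *: v - toR2 R y).
  rewrite toR2D !toR2MN !scalerBr !scalerA -!natrM [(m * n)%N]mulnC scalerDr.
  by rewrite opprD addrACA.
have := l1D (m%:R *: (n%:R *: u - toR2 R x)) (n%:R *: (m%:R *: v - toR2 R y)).
rewrite !l1Z !normr_nat => /(ler_wpM2l (ltW b_gt0)) le_l1.
have := phiD (x *+ m) (y *+ n); have := phiMn x m; have := phiMn y n.
move: xn ym; rewrite -(ltr_pM2l (_ : 0 < m%:R :> R)) ?ltr0n// => xn.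
rewrite -(ltr_pM2l (_ : 0 < n%:R :> R)) ?ltr0n// => ym.
rewrite -[X in _ <= X -> _]mulr_natl -[X in _ -> _ <= X -> _]mulr_natl natrM.
move=> le1 le2 le3 le4; have nm_gt0 : 0 < n%:R * m%:R :> R by rewrite -natrM ltr0n.
rewrite -(ler_pM2l nm_gt0); lra.
Qed.

Lemma rhoN u : rho (- u) = rho u.
Proof.
suff le_rho v : rho (- v) <= rho v.
  by apply/eqP; rewrite eq_le le_rho -{1}[u]opprK le_rho.
apply: rho_ge => n z n0; have := rho_le (- z) (- v) n0.
by rewrite phiN scalerN toR2N -opprD l1N.
Qed.

Lemma rho_lipschitz u v : `|rho u - rho v| <= b * l1 (u - v).
Proof.
have le_rho p q : rho p <= rho q + b * l1 (p - q).
  have := rhoD (p - q) q; rewrite subrK addrC => /le_trans; apply.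
  by rewrite lerD2l rho_le_l1.
rewrite ler_norml; have := le_rho u v; have := le_rho v u.
by rewrite [l1 (v - u)]l1B; lra.
Qed.

(** Subadditivity gives one inequality; for the other, a competitor [(m, z)] for [n u] yields the
    competitor [(m n, z)] for [u]. *)
Lemma rhoMn n u : rho (n%:R *: u) = n%:R * rho u.
Proof.
apply/eqP; rewrite eq_le; apply/andP; split.
  elim: n => [|n IHn]; first by rewrite scale0r rho0 mul0r.
  rewrite -natr1 scalerDl mulrDl scale1r mul1r (le_trans (rhoD _ _))//.
  by rewrite lerD2r.
have [->|n0] := posnP n; first by rewrite mul0r rho_ge0.
apply: rho_ge => m z m0; rewrite mulrA -natrM scalerA -natrM.
by apply: rho_le; rewrite muln_gt0 m0.
Qed.

(** [n] times the defect stays bounded in [n]: replace [n c] by its integer part, where homogeneity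
    is known, at a cost controlled by the Lipschitz bound. *)
Lemma rhoZ_ge0 c u : 0 <= c -> rho (c *: u) = c * rho u.
Proof.
move=> c0; apply/eqP; rewrite -subr_eq0 -normr_le0.
apply: (@bounded_multiples_le0 _ _ (b * l1 u + rho u)) => n.
pose m := Num.truncn (n%:R * c).
have /andP[m_le m_gt] : m%:R <= n%:R * c < m.+1%:R.
  by rewrite truncn_itv// mulr_ge0.
rewrite -natr1 in m_gt.
have nm : `|n%:R * c - m%:R| <= 1 by rewrite ger0_norm; lra.
rewrite -mulr_natl -[n%:R in leLHS]normr_nat -normrM mulrBr -rhoMn scalerA mulrA.
have -> : rho ((n%:R * c) *: u) - n%:R * c * rho u =
    (rho ((n%:R * c) *: u) - rho (m%:R *: u)) - (n%:R * c - m%:R) * rho u.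
  by rewrite rhoMn; ring.
rewrite (le_trans (ler_normB _ _))// lerD//.
  rewrite (le_trans (rho_lipschitz _ _))// -scalerBl l1Z.
  by rewrite ler_wpM2l ?(ltW b_gt0)// ler_piMl ?l1_ge0.
by rewrite normrM (ger0_norm (rho_ge0 u)) ler_piMl ?rho_ge0.
Qed.

Lemma is_norm_rho : is_norm rho.
Proof.
split=> [||c u|]; [exact: rho_ge0| |..|exact: rhoD].
  move=> u u0; apply: l1_eq0; have := rho_ge_l1 u; rewrite u0 pmulr_rle0// => ?.
  by apply/eqP; rewrite eq_le l1_ge0 andbT.
have [c0|c0] := ger0P c; first exact: rhoZ_ge0.
by rewrite -[c in c *: _]opprK scaleNr rhoN rhoZ_ge0// oppr_ge0 ltW.
Qed.

Lemma rho_le_phi n x : n%:R * rho (toR2 R x) <= phi (x *+ n).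
Proof.
have [->|n0] := posnP n; first by rewrite mul0r mulr0n phi0.
have := rho_le (x *+ n) (toR2 R x) n0.
by rewrite -toR2MN subrr l1_0 mulr0 addr0.
Qed.

(** At a lattice point subadditivity of [phi] absorbs the penalty:
    [phi (n x) <= phi z + b * l1 (n x - z)]. With [rho_le_phi], [rho x] is thus the infimum of
    [phi (n x) / n]. *)
Lemma phi_adherent c x : rho (toR2 R x) < c ->
  exists2 n, (0 < n)%N & phi (x *+ n) < n%:R * c.
Proof.
move=> /rho_adherent[n [z [n0 lt_c]]]; exists n => //; apply: le_lt_trans lt_c.
rewrite -toR2MN -toR2B -{1}[x *+ n](subrK z) addrC (le_trans (phiD _ _))//.
by rewrite lerD2l phi_le_l1.
Qed.

(** * Almost sure growth along a fixed direction *)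

Lemma Pr_setU A B : measurable A -> measurable B -> Pr (A `|` B) <= Pr A + Pr B.
Proof.
move=> mA mB; rewrite -lee_fin EFinD !EFin_Pr//; last exact: measurableU.
exact: measureU2.
Qed.

Lemma measurable_infinitely_often (A : nat -> set (weights R)) :
  (forall n, measurable (A n)) ->
  measurable [set w | forall N, exists2 n, (N < n)%N & A n w].
Proof.
move=> mA; rewrite (_ : mkset _ =
    \bigcap_N \bigcup_(n in [set n | (N < n)%N]) A n).
  by apply: bigcapT_measurable => N; exact: bigcup_measurable.
apply/seteqP; split=> w Aw N; first by move=> _; have [n] := Aw N; exists n.
by have [n] := Aw N I; exists n.
Qed.

Let upper_bad x (c : R) := [set w | forall N, exists2 n, (N < n)%N &
  c *+ n <= d w 0 (x *+ n)].

Let lower_bad x (c : R) := [set w | forall N, exists2 n, (N < n)%N &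
  d w 0 (x *+ n) <= c *+ n].

Let measurable_upper_bad x c : measurable (upper_bad x c).
Proof.
apply: measurable_infinitely_often => n.
by apply: measurable_superlevel; exact: measurable_d.
Qed.

Let measurable_lower_bad x c : measurable (lower_bad x c).
Proof.
apply: measurable_infinitely_often => n.
by apply: measurable_sublevel; exact: measurable_d.
Qed.

(** The bound does not depend on [y], so linear growth rates are the same from every origin; this
    makes [ergodic_orbit] applicable. *)
Lemma d_move_origin w z y :
  `|d (translate z w) 0 y - d w 0 y| <= b * l1 (toR2 R z) *+ 2.
Proof.
rewrite d_translate (le_trans (d_lipschitz _ _ _ _ _))//.
by rewrite add0r subr0 (addrC y) addrK -mulr2n mulrnAr.
Qed.

Lemma d_le_birkhoff x n w :
  d w 0 (x *+ n) <= birkhoff_sum x (fun w => d w 0 x) n w.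
Proof.
elim: n => [|n IHn]; rewrite /birkhoff_sum ?big_ord0 ?big_ord_recr.
  rewrite mulr0n (le_trans (d_le_l1 _ _ _))// subrr toR2_0.
  by rewrite l1_0 mulr0.
rewrite (le_trans (d_triangle _ (x *+ n) _ _))// lerD//=.
by rewrite d_translate add0r mulrS.
Qed.

(** Growth at rate [c] with positive probability would make the Birkhoff sums of [d 0 (m x)] reach
    rate [m c'] almost surely. The maximal inequality would then give [m c' <= phi (m x)], against
    the choice of [m]. *)
Lemma upper_direction x c : rho (toR2 R x) < c -> Pr (upper_bad x c) = 0.
Proof.
move=> rho_c; apply/eqP; rewrite eq_le Pr_ge0 andbT leNgt; apply/negP => bad0.
pose c' := (rho (toR2 R x) + c) / 2.
have c'_c : c' < c by rewrite /c'; lra.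
have c'_ge0 : 0 <= c' by rewrite /c'; have := rho_ge0 (toR2 R x); lra.
have [m m0 phi_m] : exists2 m, (0 < m)%N & phi (x *+ m) < m%:R * c'.
  by apply: phi_adherent; rewrite /c'; lra.
pose f w := d w 0 (x *+ m); have bf : bounded_mfun f by exact: bounded_d.
pose B := [set w | exists2 k, (0 < k)%N &
  (m%:R * c') *+ k <= birkhoff_sum (x *+ m) f k w].
have mB : measurable B.
  rewrite (_ : B = \bigcup_(k in [set k | (0 < k)%N])
    [set w | (m%:R * c') *+ k <= birkhoff_sum (x *+ m) f k w]).
    apply: bigcup_measurable => k _; apply: measurable_superlevel.
    by case: (bounded_mfun_birkhoff (x *+ m) k bf).
  by apply/seteqP; split=> w [k]; exists k.
have : m%:R * c' * Pr B <= phi (x *+ m).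
  apply: (maximal_inequality statP) => [n|n w|n k w||n].
  - exact: bounded_mfun_birkhoff.
  - by apply: sumr_ge0 => j _; exact: d_ge0.
  - by rewrite birkhoff_sumD.
  - by rewrite mulr_ge0.
  - by rewrite (Ex_birkhoff statP).
rewrite (ergodic_orbit ergP (measurable_upper_bad x c) mB bad0) ?mulr1.
  by rewrite leNgt phi_m.
(* [K] bounds the cost of moving the origin by [z] and of rounding [n] down to a multiple of [m]. A
   large [n] makes the gap [n (c - c')] absorb it, and [n > m] makes the quotient positive. *)
move=> z w bad_w; pose K := b * l1 (toR2 R z) *+ 2 + b * l1 (toR2 R x) *+ m.
have [n] := bad_w (maxn m (Num.truncn (K / (c - c')))).
rewrite gtn_max => /andP[mn Kn] le_d.
exists (n %/ m)%N; first by rewrite divn_gt0// ltnW.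
apply: le_trans (d_le_birkhoff _ _ _); rewrite -mulrnA.
have K_le : K <= n%:R * (c - c').
  rewrite -ler_pdivrMr ?subr_gt0// (le_trans (ltW (truncnS_gt _)))// ler_nat.
  exact: Kn.
have := d_move_origin w z (x *+ n); rewrite ler_norml => /andP[_ move_z].
have := d_lipschitz w 0 (x *+ n) 0 (x *+ (m * (n %/ m))).
rewrite subrr toR2_0 l1_0 add0r ler_norml => /andP[_].
have -> : x *+ n - x *+ (m * (n %/ m)) = x *+ (n %% m).
  by rewrite {1}(divn_eq n m) mulnC mulrnDr addrC addKr.
rewrite toR2MN l1Z normr_nat => move_r.
have := ltn_pmod n m0 => /ltnW; rewrite -(ler_nat R).
move=> /(ler_wpM2r (l1_ge0 (toR2 R x)))/(ler_wpM2l (ltW b_gt0)) le_r.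
have : (m * (n %/ m))%:R <= n%:R :> R by rewrite ler_nat mulnC leq_trunc_div.
move=> /(ler_wpM2r c'_ge0) le_c'.
move: le_d K_le le_c'; rewrite /K natrM -[c *+ n]mulr_natl.
rewrite -[_ *+ (n %/ m)]mulr_natl -[_ *+ m]mulr_natl; lra.
Qed.

(** The same scheme for [L n - d 0 (n x)], which is nonnegative by the choice of [L] and
    superadditive by the triangle inequality. Its mean is at most [(L - rho x) n]. *)
Lemma lower_direction x c : c < rho (toR2 R x) -> Pr (lower_bad x c) = 0.
Proof.
move=> rho_c; apply/eqP; rewrite eq_le Pr_ge0 andbT leNgt; apply/negP => bad0.
pose c' := (rho (toR2 R x) + c) / 2.
have c_c' : c < c' by rewrite /c'; lra.
have c'_rho : c' < rho (toR2 R x) by rewrite /c'; lra.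
pose L := b * l1 (toR2 R x).
have c'_L : c' <= L by rewrite (le_trans (ltW c'_rho))// rho_le_l1.
pose X n w := L *+ n - d w 0 (x *+ n).
have bX n : bounded_mfun (X n).
  apply: bounded_mfunD; first exact: bounded_mfun_cst.
  by apply: bounded_mfunN; exact: bounded_d.
pose B := [set w | exists2 k, (0 < k)%N & (L - c') *+ k <= X k w].
have mB : measurable B.
  rewrite (_ : B = \bigcup_(k in [set k | (0 < k)%N])
    [set w | (L - c') *+ k <= X k w]).
    apply: bigcup_measurable => k _; apply: measurable_superlevel.
    by case: (bX k).
  by apply/seteqP; split=> w [k]; exists k.
have : (L - c') * Pr B <= L - rho (toR2 R x).
  apply: (maximal_inequality statP (z := x)) => // [n w|n k w||n].
  - rewrite subr_ge0 (le_trans (d_le_l1 _ _ _))// sub0r toR2N l1N toR2MN l1Z.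
    by rewrite normr_nat mulrCA mulr_natl.
  - rewrite /X d_translate add0r !mulrnDr [x *+ n + _]addrC addrACA lerD2l.
    by rewrite -opprD lerN2; exact: d_triangle.
  - by rewrite subr_ge0.
  - rewrite /X ExB; [|exact: bounded_mfun_cst|exact: bounded_d].
    by rewrite Ex_cst mulrnBl lerD2l lerN2 -[leLHS]mulr_natl rho_le_phi.
rewrite (ergodic_orbit ergP (measurable_lower_bad x c) mB bad0) ?mulr1.
  by rewrite leNgt; apply/negP/negPn; lra.
move=> z w bad_w; pose K := b * l1 (toR2 R z) *+ 2.
have [n n_gt le_d] := bad_w (Num.truncn (K / (c' - c))).
exists n; first exact: leq_ltn_trans n_gt.
have K_le : K <= n%:R * (c' - c).
  rewrite -ler_pdivrMr ?subr_gt0// (le_trans (ltW (truncnS_gt _)))// ler_nat.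
  exact: n_gt.
have := d_move_origin w z (x *+ n); rewrite ler_norml => /andP[move_z _].
rewrite /X mulrnBl lerD2l lerN2 -[leRHS]mulr_natl.
by move: le_d K_le; rewrite /K -[c *+ n]mulr_natl; lra.
Qed.

(** * Limits with both endpoints moving *)

Let far x (e : R) K := [set w | exists2 n, (K < n)%N &
  e *+ n <= `|d w 0 (x *+ n) - n%:R * rho (toR2 R x)|].

Let measurable_dev x y (c r : R) :
  measurable [set w | r <= `|d w x y - c|].
Proof.
apply: measurable_superlevel; apply: measurableT_comp => //.
by apply: measurable_funB; [exact: measurable_d|exact: measurable_cst].
Qed.

Let measurable_far x e K : measurable (far x e K).
Proof.
rewrite (_ : far x e K = \bigcup_(n in [set n | (K < n)%N]) [set w |
    e *+ n <= `|d w 0 (x *+ n) - n%:R * rho (toR2 R x)|]).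
  by apply: bigcup_measurable => n _; exact: measurable_dev.
by apply/seteqP; split=> w [n]; exists n.
Qed.

(** The events decrease in [K], and their intersection lies in the union of two null events: growth
    above [r + e], or below [r - e], infinitely often. *)
Lemma far_cvg0 x e : 0 < e -> Pr (far x e K) @[K --> \oo] --> 0.
Proof.
move=> e0; set r := rho (toR2 R x).
have nif : nonincreasing_seq (far x e).
  move=> M N MN; apply/subsetPset => w [n Nn dn].
  by exists n => //; exact: leq_ltn_trans Nn.
have := Pr_nonincreasing_cvg (P := P) (measurable_far x e) nif.
rewrite (_ : Pr _ = 0)//; apply/eqP; rewrite eq_le Pr_ge0 andbT.
have mU := measurable_upper_bad x (r + e); have mL := measurable_lower_bad x (r - e).
apply: (@le_trans _ _ (Pr (upper_bad x (r + e) `|` lower_bad x (r - e)))).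
  apply: le_Pr; [exact: bigcapT_measurable|exact: measurableU|].
  move=> w far_w; apply: contrapT => /not_orP[nU nL].
  have [N1 hN1] : exists N, forall n, (N < n)%N -> d w 0 (x *+ n) < (r + e) *+ n.
    move/existsNP: nU => [N nN]; exists N => n Nn.
    by rewrite ltNge; apply/negP => dn; apply: nN; exists n.
  have [N2 hN2] : exists N, forall n, (N < n)%N -> (r - e) *+ n < d w 0 (x *+ n).
    move/existsNP: nL => [N nN]; exists N => n Nn.
    by rewrite ltNge; apply/negP => dn; apply: nN; exists n.
  have [n] := far_w (maxn N1 N2) I; rewrite gtn_max => /andP[/hN1 d1 /hN2 d2].
  rewrite leNgt; apply/negP/negPn; rewrite ltr_norml.
  by move: d1 d2; rewrite mulrnBl mulrnDl -[r *+ n]mulr_natl; lra.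
rewrite (le_trans (Pr_setU mU mL))// upper_direction ?lower_direction ?addr0//.
  by rewrite ltrBlDr ltrDl.
by rewrite ltrDl.
Qed.

Let moving_bad (x y : Z2) (e : R) := [set w | forall K, exists2 k, (K < k)%N &
  e *+ k <= `|d w (x *+ k) (y *+ k) - k%:R * rho (toR2 R (y - x))|].

(** By the maximal inequality, with probability at least [1 - m Pr (far K)], for every [n > 0] less
    than a fraction [1 / m] of the origins [j x], [j < n], is bad. Then a good [j] occurs among the
    last [k / m + 1] indices below [k], and sliding the segment from [j x] to [k x] costs at most
    [e k / 2]. *)
Lemma moving_direction x y e : 0 < e -> Pr (moving_bad x y e) = 0.
Proof.
move=> e0; pose r := rho (toR2 R (y - x)); have e2 : 0 < e / 2 by rewrite divr_gt0.
have mN : measurable (moving_bad x y e).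
  by apply: measurable_infinitely_often => k; exact: measurable_dev.
(* The cost of sliding both endpoints by [x]. *)
pose C := b * l1 (toR2 R x) *+ 2.
have C0 : 0 <= C by rewrite mulrn_wge0// mulr_ge0 ?l1_ge0 ?ltW.
(* One successor gives [C <= m e / 4]; the second makes [m > 1], so that [s <= k] below. *)
pose m := (Num.truncn (C / (e / 4))).+2.
have Cm : C <= m%:R * (e / 4).
  rewrite -ler_pdivrMr ?divr_gt0// (le_trans (ltW (truncnS_gt _)))// ler_nat.
  exact: leqnSn.
have m_gt0 : 0 < m%:R :> R by rewrite ltr0n.
have PrK K : Pr (moving_bad x y e) <= m%:R * Pr (far (y - x) (e / 2) K).
  pose f : weights R -> R := \1_(far (y - x) (e / 2) K).
  have bf : bounded_mfun f by exact: bounded_mfun_indic.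
  pose H := [set w | exists2 n, (0 < n)%N & m%:R^-1 *+ n <= birkhoff_sum x f n w].
  have mH : measurable H.
    rewrite (_ : H = \bigcup_(k in [set k | (0 < k)%N])
      [set w | m%:R^-1 *+ k <= birkhoff_sum x f k w]).
      apply: bigcup_measurable => k _; apply: measurable_superlevel.
      by case: (bounded_mfun_birkhoff x k bf).
    by apply/seteqP; split=> w [k]; exists k.
  have : m%:R^-1 * Pr H <= Pr (far (y - x) (e / 2) K).
    apply: (maximal_inequality statP) => [n|n w|n k w||n].
    - exact: bounded_mfun_birkhoff.
    - by apply: sumr_ge0 => j _; rewrite /f indicE.
    - by rewrite birkhoff_sumD.
    - by rewrite invr_ge0 ltW.
    - by rewrite (Ex_birkhoff statP)// Ex_indic.
  rewrite ler_pdivrMl// => /(le_trans _); apply.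
  apply: le_Pr => // w bad_w.
  have [k] := bad_w (maxn K m); rewrite gtn_max => /andP[Kk mk] dev_k.
  pose s := (k %/ m).+1.
  have sk : (s <= k)%N by rewrite /s ltn_Pdiv// (leq_ltn_trans _ mk).
  exists k; first exact: leq_ltn_trans mk.
  rewrite leNgt; apply/negP => lt_k.
  (* If all of the last [s] origins were bad, the Birkhoff sum up to [k] would be at least [s],
     which exceeds [k / m]. *)
  have [i good_i] : exists i : 'I_s,
      ~ far (y - x) (e / 2) K (translate (x *+ (k - s + i)) w).
    apply: contrapT => /forallNP nfar; move: lt_k; apply/negP; rewrite -leNgt.
    rewrite -(subnK sk) birkhoff_sumD.
    rewrite (@le_trans _ _ (birkhoff_sum x f s (translate (x *+ (k - s)) w)))//.
      rewrite /birkhoff_sum (eq_bigr (fun=> 1)) => [|i _].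
        rewrite sumr_const card_ord subnK// -[leLHS]mulr_natr ler_pdivrMl// -natrM.
        by rewrite ler_nat ltnW// mulnC ltn_ceil.
      rewrite translateD -mulrnDr /f indicE mem_set//.
      by have /contrapT := nfar i; rewrite addnC.
    by rewrite lerDr; apply: sumr_ge0 => j _; rewrite /f indicE.
  apply: good_i; exists k => //; rewrite leNgt; apply/negP.
  rewrite d_translate add0r mulrnBl => near_k.
  have := d_lipschitz w (x *+ k) (y *+ k) (x *+ (k - s + i))
    (y *+ k - x *+ k + x *+ (k - s + i)).
  have -> : y *+ k - (y *+ k - x *+ k + x *+ (k - s + i)) =
      x *+ k - x *+ (k - s + i).
    by rewrite opprD opprB addrA addrCA subrr addr0.
  have le_k : (k - s + i <= k)%N by rewrite -[leqRHS](subnK sk) leq_add2l ltnW.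
  rewrite -mulrnBr// toR2MN l1Z normr_nat.
  have le_s : (k - (k - s + i) <= s)%N by rewrite leq_subLR addnAC subnK// leq_addr.
  move: le_s; rewrite -(ler_nat R).
  move=> /(ler_wpM2r (l1_ge0 (toR2 R x)))/(ler_wpM2l (ltW b_gt0)) le_s move_k.
  have e4 : 0 <= e / 4 by rewrite divr_ge0// ltW.
  (* As [s] is the quotient plus one, two terms arise, each at most [e k / 4] because [C <= m e / 4]
     and [m < k]. *)
  have Cs : b * (s%:R * l1 (toR2 R x)) *+ 2 <= (e / 2) *+ k.
    have -> : b * (s%:R * l1 (toR2 R x)) *+ 2 = C * (k %/ m)%:R + C.
      by rewrite /C /s -natr1; ring.
    have C1 : C <= k%:R * (e / 4).
      by apply: (le_trans Cm); rewrite ler_wpM2r// ler_nat ltnW.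
    have C2 : C * (k %/ m)%:R <= k%:R * (e / 4).
      apply: (le_trans (ler_wpM2r (ler0n _ (k %/ m)) Cm)).
      by rewrite mulrAC -natrM ler_wpM2r// ler_nat mulnC leq_trunc_div.
    by rewrite -[leRHS]mulr_natl; lra.
  move: dev_k; rewrite leNgt; apply/negP/negPn.
  rewrite (_ : _ - k%:R * r = (d w (x *+ k) (y *+ k) - d w (x *+ (k - s + i))
    (y *+ k - x *+ k + x *+ (k - s + i))) + (d w (x *+ (k - s + i))
    (y *+ k - x *+ k + x *+ (k - s + i)) - k%:R * r)); last by rewrite addrA subrK.
  rewrite (le_lt_trans (ler_normD _ _))//.
  have -> : e *+ k = (e / 2) *+ k + (e / 2) *+ k by rewrite -mulrnDl -splitr.
  rewrite ler_ltD// (le_trans move_k)//.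
  by rewrite (le_trans _ Cs)// mulrDr mulr2n lerD.
apply/eqP; rewrite eq_le Pr_ge0 andbT.
have : m%:R * Pr (far (y - x) (e / 2) K) @[K --> \oo] --> (m%:R * 0 : R).
  by apply: cvgM; [exact: cvg_cst|exact: far_cvg0].
by rewrite mulr0 => /cvgr_to_ge; apply; exact: nearW.
Qed.

Lemma moving_limit x y e : 0 < e -> {ae P, forall w, exists K, forall k,
  (K < k)%N ->
  `|d w (x *+ k) (y *+ k) - k%:R * rho (toR2 R (y - x))| < e *+ k}.
Proof.
move=> e0; have mN : measurable (moving_bad x y e).
  by apply: measurable_infinitely_often => k; exact: measurable_dev.
have := ae_Pr0C mN (moving_direction x y e0).
apply: filterS => w /existsNP[K nK]; exists K => k Kk.
by rewrite ltNge; apply/negP => le_k; apply: nK; exists k.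
Qed.

End StationaryMetric.

(** * Uniform convergence *)

Lemma enorm_ge_coord (R : realType) (u : 'rV[R]_2) k : `|u 0 k| <= enorm u.
Proof.
rewrite -sqrtr_sqr ler_wsqrtr// (bigD1 k)//= lerDl.
by apply: sumr_ge0 => i _; exact: sqr_ge0.
Qed.

Lemma enorm_le_l1 (R : realType) (u : 'rV[R]_2) : enorm u <= l1 u.
Proof.
rewrite -(ger0_norm (l1_ge0 u)) -sqrtr_sqr ler_wsqrtr//.
rewrite big_ord_recl big_ord1 (_ : lift ord0 ord0 = 1); last exact/val_inj.
rewrite /l1 -[u 0 ord0 ^+ 2]real_normK ?num_real// -[u 0 1 ^+ 2]real_normK ?num_real//.
have := mulr_ge0 (normr_ge0 (u 0 0)) (normr_ge0 (u 0 1)).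
rewrite (_ : ord0 = 0)//; nra.
Qed.

Lemma divz_le (k n m : nat) (z : int) : (0 < k)%N -> (n <= k * m)%N ->
  `|z| <= n%:Z -> `|(z %/ k%:Z)%Z| <= m%:Z.
Proof.
move=> k0 nkm zn; have zkm : `|z| <= m%:Z * k%:Z by lia.
have k0' : 0 < k%:Z by [].
move: zkm; rewrite !ler_norml => /andP[z_ge z_le]; apply/andP; split.
  by rewrite lez_divRL// mulNr.
by rewrite -ltzD1 ltz_divLR// mulrDl mul1r (le_lt_trans z_le)// ltrDl.
Qed.

Lemma divz_rem_le (k : nat) (z : int) : (0 < k)%N ->
  `|z - (z %/ k%:Z)%Z * k%:Z| <= k%:Z.
Proof.
move=> k0; rewrite {1}(divz_eq z k%:Z) addrAC subrr add0r.
by rewrite ger0_norm ?modz_ge0 ?ltW ?ltz_pmod// eqz_nat -lt0n.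
Qed.

Section UniformLimit.
Variables (R : realType) (delta : Z2 -> Z2 -> R) (rho : 'rV[R]_2 -> R) (b : R).
Hypothesis b_gt0 : 0 < b.
Hypothesis delta_lipschitz : forall x y x' y', `|delta x y - delta x' y'| <=
  b * (l1 (toR2 R (x - x')) + l1 (toR2 R (y - y'))).
Hypothesis rho_lipschitz : forall u v, `|rho u - rho v| <= b * l1 (u - v).
Hypothesis rhoMn : forall n u, rho (n%:R *: u) = n%:R * rho u.
Hypothesis scaled_limit : forall (p : Z2 * Z2) (i : nat),
  exists K, forall k, (K < k)%N ->
  `|delta (p.1 *+ k) (p.2 *+ k) - k%:R * rho (toR2 R (p.1 - p.2))|
    < i.+1%:R^-1 *+ k.

(** Round [x] and [y] to multiples of [k = n / q]. The quotients stay in a fixed finite set, where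
    the scaled limits hold uniformly at cost [e n / 2]; for large [q] rounding costs at most
    [e n / 4] in [delta] and as much in [rho]. *)
Lemma uniform_limit (e : R) : 0 < e -> exists N, forall n, (N < n)%N ->
  forall x y, ball_pairs R n (x, y) ->
  `|delta x y - rho (toR2 R (x - y))| <= e *+ n.
Proof.
move=> e0.
have [i le_i] : exists i, i.+1%:R^-1 <= e / 2.
  exists (Num.truncn (e / 2)^-1).
  by rewrite invf_ple ?posrE ?divr_gt0// ltW// truncnS_gt.
have [q q_gt0 le_q] : exists2 q, (0 < q)%N & b * 8 <= q%:R * (e / 2).
  exists (Num.truncn (b * 8 / (e / 2))).+1 => //.
  by rewrite -ler_pdivrMr ?divr_gt0// ltW// truncnS_gt.
have [Kf hKf] := choice (fun p => scaled_limit p i).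
(* Since [n <= 2 q k], the coordinates of a quotient are at most [2 q] in absolute value, so its
   Euclidean norm is at most [4 q]. *)
pose S := fset_set (ball_pairs R (q * 4)).
pose K := \max_(p <- S) Kf p.
(* Beyond this threshold [k = n / q] exceeds [Kf p] for every [p] in [S]. *)
exists (q * K.+1)%N => n nK x y [xn yn] /=.
pose k := (n %/ q)%N.
have Kk : (K < k)%N by rewrite leq_divRL// mulnC ltnW.
have k_gt0 : (0 < k)%N by exact: leq_ltn_trans Kk.
have nk : (n <= k * (q * 2))%N.
  rewrite (leq_trans (ltnW (ltn_ceil n q_gt0)))// mulnA muln2 -addnn mulSn.
  by rewrite leq_add2r -[leqLHS]mul1n leq_mul2r k_gt0 orbT.
pose quo (z : Z2) : Z2 := \row_j (z 0%R j %/ k%:Z)%Z.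
have coord (z : Z2) (j : 'I_2) : enorm (toR2 R z) <= n%:R -> `|z 0 j| <= n%:Z.
  move=> zn; have := le_trans (enorm_ge_coord (toR2 R z) j) zn.
  by rewrite mxE -intr_norm -[n%:R]/(n%:Z%:~R) ler_int.
have quo_le (z : Z2) : enorm (toR2 R z) <= n%:R -> enorm (toR2 R (quo z)) <= (q * 4)%:R.
  move=> zn; apply: le_trans (enorm_le_l1 _) _.
  rewrite l1_toR2 -[(q * 4)%:R]/((q * 4)%:Z%:~R) ler_int !mxE.
  have quo_coord (j : 'I_2) : `|(z 0%R j %/ k%:Z)%Z| <= (q * 2)%:Z.
    by apply: (divz_le k_gt0 nk); exact: coord.
  by have := quo_coord 0; have := quo_coord 1; lia.
have rem_le (z : Z2) : l1 (toR2 R (z - quo z *+ k)) <= 2 * k%:R.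
  have rem_coord (j : 'I_2) : `|(z - quo z *+ k) 0 j| <= k%:Z.
    by rewrite !mxE mulmxnE mxE -mulr_natr natz; exact: divz_rem_le.
  rewrite l1_toR2 (_ : 2 * k%:R = (2%:Z * k%:Z)%:~R) ?intrM// -intrM ler_int.
  by rewrite (_ : 2%:Z * k%:Z = k%:Z + k%:Z) ?lerD//; lia.
pose p := (quo x, quo y).
have pS : p \in S.
  rewrite in_fset_set; last exact: finite_ball_pairs.
  by apply/mem_set; split; exact: quo_le.
have Kp : (Kf p < k)%N by apply: leq_ltn_trans Kk; exact: leq_bigmax_seq.
have le_rem : b * (l1 (toR2 R (x - quo x *+ k)) + l1 (toR2 R (y - quo y *+ k)))
    <= (e / 2 * n%:R) / 2.
  have rem4 : l1 (toR2 R (x - quo x *+ k)) + l1 (toR2 R (y - quo y *+ k)) <=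
    4 * k%:R by have := rem_le x; have := rem_le y; lra.
  have qkn : q%:R * k%:R <= n%:R :> R by rewrite -natrM ler_nat mulnC leq_trunc_div.
  have := ler_wpM2l (ltW b_gt0) rem4.
  have := ler_wpM2r (ler0n R k) le_q.
  have := ler_wpM2r (ltW (divr_gt0 e0 (ltr0Sn R 1))) qkn.
  lra.
have le_delta := delta_lipschitz x y (quo x *+ k) (quo y *+ k).
have le_rho : `|rho (toR2 R (x - y)) - k%:R * rho (toR2 R (quo x - quo y))| <=
    b * (l1 (toR2 R (x - quo x *+ k)) + l1 (toR2 R (y - quo y *+ k))).
  rewrite -rhoMn (le_trans (rho_lipschitz _ _))// ler_wpM2l ?(ltW b_gt0)//.
  rewrite -toR2MN mulrnBl -toR2B opprD addrACA -opprD.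
  by rewrite [toR2 R (_ - (_ - _))]toR2B (le_trans (l1D _ _))// l1N.
have le_k : `|delta (quo x *+ k) (quo y *+ k) -
    k%:R * rho (toR2 R (quo x - quo y))| <= e / 2 * n%:R.
  apply: (le_trans (ltW (hKf p k Kp))); rewrite -[leLHS]mulr_natr.
  rewrite (le_trans (ler_wpM2r (ler0n R k) le_i))// ler_wpM2l ?divr_ge0 ?(ltW e0)//.
  by rewrite ler_nat leq_div.
move: (le_trans le_delta le_rem) (le_trans le_rho le_rem) le_k.
by rewrite -[e *+ n]mulr_natr !ler_norml; lra.
Qed.

End UniformLimit.

(** * Almost sure bounds on the weights *)

Lemma compact_pos_bounds (R : realType) (K : set R) : compact K ->
  K `<=` [set t | 0 < t] ->
  exists a b : {posnum R}, K `<=` [set t | a%:num <= t <= b%:num].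
Proof.
move=> cK K0; have [M [_ KM]] := compact_bounded cK.
have closed_K : open (~` K).
  by apply: closed_openC; apply: compact_closed => //; exact: Rhausdorff.
have n0K : (~` K) 0 by move/K0 => /=; rewrite ltxx.
have /nbhs_ballP[e /= e0 eK] := open_nbhs_nbhs (conj closed_K n0K).
(* A ball around 0 in the open complement of [K] gives the lower bound. [KM] applies to numbers
   strictly above [M], which may be negative; hence [|M| + 1]. *)
exists (PosNum e0), (PosNum (ltr_pwDr ltr01 (normr_ge0 M))) => t Kt /=.
rewrite (le_trans (ler_norm t)) ?KM// ?(le_lt_trans (ler_norm M)) ?ltrDl//.
rewrite andbT leNgt; apply/negP => te; apply: (eK t) => //.
by rewrite /ball /= sub0r normrN gtr0_norm// K0.
Qed.

Section WeightBounds.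
Variables (R : realType) (P : probability (weights R) R).
Hypotheses (statP : stationary P) (compP : compact_marginals P).

Let measurable_between (a b : R) e :
  measurable [set w : weights R | a <= weight e w <= b].
Proof.
rewrite (_ : mkset _ = [set w | a <= weight e w] `&` [set w | weight e w <= b]).
  apply: measurableI; [apply: measurable_superlevel|apply: measurable_sublevel];
    exact: measurable_weight.
by apply/seteqP; split=> w; [move=> /andP|move=> [? ?]; apply/andP].
Qed.

(** Edges in direction [k] are translates of the one at the origin, so by stationarity the bounds
    for its marginal serve them all. *)
Let direction_bounds k : exists a b : {posnum R},
  {ae P, forall w, forall z, a%:num <= weight (z, k) w <= b%:num}.
Proof.
have [K [cK K0 PK]] := compP (0, k).
have [a [b Kab]] := compact_pos_bounds cK K0; exists a, b.
apply: ae_forall_countable => z.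
have := @ae_Pr1 _ P [set w | a%:num <= weight (z, k) w <= b%:num].
apply; first exact: measurable_between.
have := statP z (measurable_between a%:num b%:num (0, k)).
rewrite (_ : translate z @^-1` _ = [set w | a%:num <= weight (z, k) w <= b%:num]).
  move=> ->; apply/eqP; rewrite eq_le probability_le1//= -PK.
  rewrite /distribution /pushforward; apply: le_measure; rewrite ?inE//;
    last by move=> w; exact: Kab.
  rewrite -[X in measurable X]setTI; apply: measurable_weight => //.
  by apply: closed_measurable; apply: compact_closed => //; exact: Rhausdorff.
by apply/seteqP; split=> w; rewrite /= /weight /translate /= add0r.
Qed.

Lemma weights_bounded : exists a b : {posnum R},
  {ae P, forall w, forall e, a%:num <= weight e w <= b%:num}.
Proof.
have [a0 [b0 ab0]] := direction_bounds 0.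
have [a1 [b1 ab1]] := direction_bounds 1.
exists (Num.min a0%:num a1%:num)%:pos, (Num.max b0%:num b1%:num)%:pos.
apply: filterS2 ab0 ab1 => w ab0 ab1 [z k] /=; rewrite ge_min le_max.
by case: (ord2P k) => ->; [have /andP[-> ->] := ab0 z|have /andP[-> ->] := ab1 z];
  rewrite ?orbT.
Qed.

End WeightBounds.

(** * Return from the truncated to the original weights *)

Theorem theorem1p3 (R : realType) (P : probability (weights R) R)
    (hP : admissible P) :
  exists rho : 'rV[R]_2 -> R, is_norm rho /\
    {ae P, forall w : weights R, max_deviation rho w n @[n --> \oo] --> 0}.
Proof.
have [statP ergP compP] := hP.
have [a [b ae_ab]] := weights_bounded statP compP.
pose d w := D (clamp a b w).
(* The order of [a] and [b] is not recorded; their sum bounds the clamped weights in either case. *)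
pose c : R := a%:num + b%:num; have c_gt0 : 0 < c by rewrite /c.
have wc w e : weight e (clamp a b w) <= c.
  by rewrite weight_clamp ge_max lerDl ge0 /= ge_min lerDr ge0.
have aw w e : a%:num <= weight e (clamp a b w) by rewrite weight_clamp le_max lexx.
have md x y := measurable_D_clamp a b x y.
have d_ge w x y : a%:num * l1 (toR2 R (x - y)) <= d w x y by exact: D_ge_l1.
have d_le w x y : d w x y <= c * l1 (toR2 R (x - y)) by exact: D_le_l1.
have d_tri w y x z : d w x z <= d w x y + d w y z by exact: D_triangle.
have d_sym w x y : d w x y = d w y x by exact: D_sym.
have d_tr z w x y : d (translate z w) x y = d w (x + z) (y + z).
  exact: (D_translate z (clamp a b w) x y).
have a_gt0 : 0 < a%:num by [].
exists (rho P d c); split; first exact: (is_norm_rho statP a_gt0).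
have ae_lim : {ae P, forall w, forall pi : Z2 * Z2 * nat, exists K, forall k,
    (K < k)%N -> `|d w (pi.1.1 *+ k) (pi.1.2 *+ k) -
      k%:R * rho P d c (toR2 R (pi.1.2 - pi.1.1))| < pi.2.+1%:R^-1 *+ k}.
  apply: ae_forall_countable => -[[x y] i] /=.
  exact: (moving_limit statP ergP a_gt0).
apply: filterS2 ae_ab ae_lim => w wab w_lim.
have dE : D w = d w by rewrite /d clamp_id.
apply/cvgrPdist_le => e e0.
have [N hN] : exists N, forall n, (N < n)%N -> forall x y, ball_pairs R n (x, y) ->
    `|D w x y - rho P d c (toR2 R (x - y))| <= e *+ n.
  apply: (uniform_limit c_gt0) => //.
  - by move=> x y x' y'; rewrite dE; exact: d_lipschitz.
  - exact: (rho_lipschitz statP a_gt0).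
  - exact: (rhoMn statP a_gt0).
  (* The limit along moving points involves [y - x], the uniform limit [x - y]; symmetry of [d]
     exchanges the two points. *)
  move=> [x y] i; have [K hK] := w_lim (y, x, i); exists K => k /hK /=.
  by rewrite dE d_sym.
exists N.+1 => // n /= Nn; rewrite sub0r normrN.
have [[x y] xy [-> _]] := max_deviation_attained (rho P d c) w n.
rewrite ger0_norm ?divr_ge0 ?normr_ge0// ler_pdivrMr ?ltr0n; last exact: leq_ltn_trans Nn.
by rewrite mulr_natr; apply: hN.
Qed.
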